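(* Let $p\in\mathbb R[x_1,x_2,x_3]$ be a polynomial of degree $d$ all of whose (nonzero) coefficients are positive, and suppose $p(x)=1$ whenever $x_1+x_2+x_3=1$. Let $N(p)$ be the number of distinct monomials appearing in $p$ with nonzero coefficient. Then $$d\le \frac{N(p)-1}{2}.$$ *)

(* Defs.v *)
From HB Require Import structures.
From mathcomp Require Import all_boot all_order all_algebra.
Set Implicit Arguments. Unset Strict Implicit. Unset Printing Implicit Defensive.
Import Order.TTheory GRing.Theory Num.Theory.
Local Open Scope ring_scope.

(* A polynomial p in R[x1,x2,x3] is represented by its support
   [s : seq (nat * nat * nat)] (a duplicate-free list of exponent triples
   (a1,a2,a3) of the monomials x1^a1 x2^a2 x3^a3 occurring in p) together
   with a coefficient function [c]; p = \sum_(m <- s) c m * x^m. *)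

Definition monom (R : nzRingType) (m : nat * nat * nat) (x1 x2 x3 : R) : R :=
  x1 ^+ m.1.1 * x2 ^+ m.1.2 * x3 ^+ m.2.

Definition peval3 (R : nzRingType) (s : seq (nat * nat * nat))
  (c : nat * nat * nat -> R) (x1 x2 x3 : R) : R :=
  \sum_(m <- s) c m * monom m x1 x2 x3.

Definition mdeg (m : nat * nat * nat) : nat := (m.1.1 + m.1.2 + m.2)%N.

Definition pdeg3 (s : seq (nat * nat * nat)) : nat := \max_(m <- s) mdeg m.

(* Main.v *)
Require Import Defs.
From HB Require Import structures.
From mathcomp Require Import all_boot all_order all_algebra.
From mathcomp Require Import ring lra zify.
Import Order.TTheory GRing.Theory Num.Theory.
Local Open Scope ring_scope.

(* The plane x1 + x2 + x3 = 1 contains, for every x <> 0, 1, the surface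
     x1 = w1 (1 + x u) (1 + x v),  x2 = w2 u v,  x3 = w3 (1 + u) (1 + v).
   Put g_m(u) = (1 + x u)^m1 u^m2 (1 + u)^m3. Then p = 1 reads
     \sum_m c_m w^m g_m(u) g_m(v) - 1 = 0  for all u, v:
   the N + 1 functions g_m and 1 span an isotropic space for a nondegenerate
   diagonal form, so N + 1 >= 2 rank. It remains to see that for some x they
   span all polynomials of degree <= d = deg p in u, for then N + 1 >= 2 (d + 1).

   Treat x as an indeterminate 'X and let Phi be a functional over R['X]
   killing 1 and all g_m. Write 1 - p = (1 - x1 - x2 - x3) \sum_l q_l with q_l
   homogeneous of degree l; positivity of p gives q_l <> 0 for l < d. If x1^a is
   the largest power of x1 dividing every monomial of p of degree >= j, test Phi
   on (1 + 'X u)^a u^(j - a), for j = 0, .., d. If all these values are divisible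
   by 'X^v, their coefficients at 'X^v vanish too, by induction on j: modulo
   'X^(v+1) the factor 1 + 'X u acts as 1, and monomials are grouped according
   to their degree n in (x2, x3). If a group n occurs, it provides a polynomial
   of degree n. If the groups n, .., n + j - 1 are empty, then the next one, with
   x1 = 1, is divisible by (x2 + x3)^(j+1); its coefficients being positive, it
   has at least j + 2 distinct exponents of x3, which is enough to produce a
   polynomial of degree n. Hence the values are divisible by all powers of 'X,
   so Phi = 0. *)

Set Implicit Arguments. Unset Strict Implicit. Unset Printing Implicit Defensive.

(** * Isotropy: from linear independence to a bound on the number of monomials *)

Definition exponent : Type := (nat * nat * nat)%type.

Definition sample (A : nzRingType) (x : A) (m : exponent) (u : A) : A :=
  monom m (1 + x * u) u (1 + u).

(* The column of index 0, with exponent (0,0,0), stands for the constant 1. *)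
Definition sample_mx (A : nzRingType) (x : A) (d : nat) (s : seq exponent) :
    'M[A]_(d.+1, (size s).+1) :=
  \matrix_(i, j) sample x (nth (0, 0, 0)%N ((0, 0, 0)%N :: s) j) i%:R.

(** A zero product bounds rank (E D) + rank E^T by n, and the invertible D preserves the rank of
    E. *)
Lemma isotropic_rank (F : fieldType) (m n : nat) (E : 'M[F]_(m, n)) (D : 'rV[F]_n) :
  (forall j, D 0 j != 0) -> E *m diag_mx D *m E^T = 0 -> row_free E -> (2 * m <= n)%N.
Proof.
move=> D_neq0 EDE0 freeE.
have unitD : diag_mx D \in unitmx.
  by rewrite unitmxE det_diag unitfE; apply/prodf_neq0 => j _; exact: D_neq0.
have /mulmx0_rank_max := EDE0.
rewrite mxrank_tr mxrankMfree ?row_free_unit //.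
by move/eqP: freeE => ->; rewrite addnn mul2n.
Qed.

Lemma size_of_row_free (R : realFieldType) (s : seq exponent) (c : exponent -> R)
    (d : nat) (x : R) :
  (forall m, m \in s -> 0 < c m) ->
  (forall x1 x2 x3 : R, x1 + x2 + x3 = 1 -> peval3 s c x1 x2 x3 = 1) ->
  x != 0 -> x != 1 -> row_free (sample_mx x d s) -> (2 * d.+1 <= (size s).+1)%N.
Proof.
move=> c_gt0 p1 x_neq0 x_neq1; set E := sample_mx _ _ _.
have x1_neq0 : 1 - x != 0 by rewrite subr_eq0 eq_sym.
(* The weights are (w1, x, w3): they are forced by x1 + x2 + x3 = 1 for all u, v. *)
pose w1 := (1 - x)^-1; pose w3 := - x / (1 - x).
pose cw m := c m * monom m w1 x w3.
pose D : 'rV[R]_((size s).+1) :=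
  \row_j (if j == ord0 then -1 else cw (nth (0, 0, 0)%N ((0, 0, 0)%N :: s) j)).
apply: (@isotropic_rank _ _ _ E D).
  move=> j; rewrite !mxE; case: (unliftP ord0 j) => [k|] -> /=; last by rewrite oppr_eq0 oner_eq0.
  have cm := c_gt0 _ (mem_nth (0, 0, 0)%N (ltn_ord k)).
  rewrite /cw /monom mulf_neq0 ?(gt_eqF cm) //.
  by rewrite !mulf_neq0 ?expf_neq0 // ?mulf_neq0 ?invr_eq0 ?oppr_eq0.
(* Entry (a, b) is p - 1 at the point of the surface with u = a, v = b; the constant column, of
   weight -1, provides the - 1. *)
apply/matrixP => a b; rewrite !mxE big_ord_recl.
rewrite mul_mx_diag !mxE /= {1 2}/sample /monom !expr0 !mulr1 mulrN1.
apply/eqP; rewrite addrC subr_eq0; apply/eqP.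
set u : R := a%:R; set v : R := b%:R.
rewrite -(p1 (w1 * (1 + x * u) * (1 + x * v)) (x * u * v) (w3 * (1 + u) * (1 + v))); last first.
  by rewrite /w1 /w3; field.
rewrite /peval3 (big_nth (0, 0, 0)%N) big_mkord; apply: eq_bigr => i _.
rewrite !mxE /= /cw /sample /monom -/u -/v !exprMn; ring.
Qed.

(** * Specialization of the indeterminate x *)

Lemma exists_horner_neq0 (R : realFieldType) (p : {poly R}) : p != 0 -> exists x, p.[x] != 0.
Proof.
move=> p_neq0.
have [/allP all0|/allPn[x _ px]] := boolP (all (root p) [seq k%:R | k <- iota 0 (size p)]); last by exists x.
case/negP: p_neq0; apply/eqP.
apply: (@roots_geq_poly_eq0 _ _ [seq k%:R | k <- iota 0 (size p)]); first exact/allP.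
- by rewrite map_inj_uniq ?iota_uniq // => k l /eqP; rewrite eqr_nat => /eqP.
- by rewrite size_map size_iota.
Qed.

Lemma poly_horner_eq0 (R : realFieldType) (p : {poly R}) : (forall x, p.[x] = 0) -> p = 0.
Proof.
by move=> p0; apply/eqP; apply/negPn/negP => /exists_horner_neq0[x]; rewrite p0 eqxx.
Qed.

(** Weights [y] at the nodes 0, .., d encode a functional. If only the zero functional over R['X]
    kills all columns, the Gram determinant is a nonzero polynomial, and any x other than 0, 1 and
    its roots will do. *)
Lemma exists_row_free (R : realFieldType) (s : seq exponent) (d : nat) :
  (forall y : 'I_d.+1 -> {poly R},
     (forall m, m \in (0, 0, 0)%N :: s -> \sum_i y i * sample 'X m i%:R = 0) ->
     forall i, y i = 0) ->
  exists x : R, [/\ x != 0, x != 1 & row_free (sample_mx x d s)].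
Proof.
move=> ker0; pose E := sample_mx ('X : {poly R}) d s.
have EevalE x : map_mx (horner_eval x) E = sample_mx x d s.
  apply/matrixP => i j; rewrite !mxE /horner_eval /sample /monom.
  by rewrite !(hornerE, horner_exp) -polyC_natr !hornerE.
have det_neq0 : \det (E *m E^T) != 0.
  apply/det0P => -[v v_neq0 vE0]; case/negP: v_neq0; apply/eqP/rowP => i; rewrite mxE.
  suff vE : v *m E = 0.
    apply: (ker0 (fun i => v 0 i)) => m m_s.
    have lt_m : (index m ((0, 0, 0)%N :: s) < (size s).+1)%N by rewrite -(index_mem m) in m_s.
    have /matrixP/(_ 0 (Ordinal lt_m)) := vE; rewrite !mxE => {2}<-.
    by apply: eq_bigr => k _; rewrite !mxE /= nth_index.
  apply/rowP => j; rewrite mxE.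
  (* A sum of squares of real polynomials vanishes only if all terms do. *)
  have : (v *m E) *m (v *m E)^T = 0 by rewrite trmx_mul mulmxA -(mulmxA v) vE0 mul0mx.
  move/matrixP/(_ 0 0); rewrite !mxE => sq0.
  apply: poly_horner_eq0 => x.
  have := congr1 (horner_eval x) sq0.
  rewrite /horner_eval horner_sum horner0 => /eqP.
  rewrite psumr_eq0; last by move=> k _; rewrite !mxE hornerM -expr2 sqr_ge0.
  move/allP/(_ j (mem_index_enum _)) => /=.
  by rewrite [_^T _ _]mxE hornerM mulf_eq0 orbb => /eqP; rewrite mxE.
pose q := \det (E *m E^T) * ('X * ('X - 1%:P)).
have q_neq0 : q != 0 by rewrite !mulf_neq0 ?polyX_eq0 ?polyXsubC_eq0.
have [x qx] := exists_horner_neq0 q_neq0.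
exists x; move: qx; rewrite !hornerM hornerX hornerXsubC !mulf_eq0 !negb_or subr_eq0.
  move=> /andP[detx /andP[-> ->]].
split=> //; rewrite -EevalE.
have : \det (map_mx (horner_eval x) E *m (map_mx (horner_eval x) E)^T) != 0.
  by rewrite map_trmx -map_mxM det_map_mx.
rewrite -unitfE -unitmxE -row_free_unit /row_free => /eqP rk.
rewrite eqn_leq rank_leq_row /= -{1}rk; exact: mxrankM_maxl.
Qed.

(** * Sparse multiples of powers of 1 + 'X *)

(* Each operator 'X * d/d'X - k removes the exponent k and costs one factor 1 + 'X. *)
Lemma dvdp_exp_support (R : realFieldType) (cs : seq nat) (p : {poly R}) (m : nat) :
  p != 0 -> (forall i, p`_i != 0 -> i \in cs) -> (1 + 'X) ^+ m %| p -> (m < size cs)%N.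
Proof.
elim: cs p m => [|k cs IH] p m p_neq0 supp dvd_p.
  by have := supp (size p).-1; rewrite -lead_coefE lead_coef_eq0 p_neq0 => /(_ isT).
case: m dvd_p => [//|m] dvd_p; rewrite ltnS.
pose q := 'X * p^`() - k%:R *: p.
have qE i : q`_i = (i%:R - k%:R) * p`_i.
  rewrite coefB coefZ coefXM mulrBl.
  by case: i => [|i] /=; rewrite ?mulr0n ?mul0r ?coef_deriv ?mulr_natl; reflexivity.
have dvd_q : (1 + 'X) ^+ m %| q.
  case/dvdpP: dvd_p => r pE; apply/dvdpP.
  exists ('X * r^`() * (1 + 'X) + 'X * r * m.+1%:R - k%:R *: r * (1 + 'X)).
  rewrite /q pE derivM deriv_exp derivD derivX derivC /= add0r mul1r -mul_polyC exprS -mulr_natl.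
  rewrite -[k%:R *: r]mul_polyC; ring.
have [q0|q_neq0] := eqVneq q 0; last first.
  apply: IH dvd_q => // i; rewrite qE mulf_eq0 negb_or subr_eq0 eqr_nat => /andP[i_k pi].
  by have := supp i pi; rewrite inE (negPf i_k).
(* There remains q = 0: then p is a nonzero monomial, and -1 is not a root. *)
have pE : p = p`_k *: 'X^k.
  apply/polyP => i; rewrite coefZ coefXn; case: eqVneq => [->|i_k]; first by rewrite mulr1.
  have /eqP := qE i; rewrite q0 coef0 eq_sym mulf_eq0 subr_eq0 eqr_nat (negPf i_k) /= mulr0.
  by move/eqP.
exfalso; move: dvd_p; rewrite exprSr pE.
have pk : p`_k != 0 by apply: contraNneq p_neq0 => pk0; rewrite pE pk0 scale0r.
rewrite dvdpZr // => /(dvdp_trans (dvdp_mull _ (dvdpp _))).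
rewrite (_ : 1 + 'X = 'X - (-1)%:P) ?dvdp_XsubCl; last by rewrite polyCN opprK addrC.
by rewrite /root hornerXn expf_eq0 oppr_eq0 oner_eq0 andbF.
Qed.

(** The binomial coefficient of 'X over l as a polynomial: a linear relation between the C(k, l)
    becomes a root k. *)
Definition binp (R : realFieldType) (l : nat) : {poly R} :=
  (l`!%:R)^-1 *: \prod_(i < l) ('X - i%:R%:P).

Lemma horner_binp (R : realFieldType) l k : (binp R l).[k%:R] = 'C(k, l)%:R.
Proof.
rewrite /binp hornerZ horner_prod; apply: (mulfI (_ : l`!%:R != 0)).
  by rewrite pnatr_eq0 -lt0n fact_gt0.
rewrite mulrA divff ?pnatr_eq0 -?lt0n ?fact_gt0 // mul1r -natrM mulnC bin_ffact.
elim: l => [|l IH]; first by rewrite big_ord0 ffactn0.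
rewrite big_ord_recr /= IH ffactnSr !hornerE natrM.
have [lt_kl|le_lk] := ltnP k l; last by rewrite natrB.
by rewrite ffact_small // !mul0r.
Qed.

Lemma size_binp (R : realFieldType) l : size (binp R l) = l.+1.
Proof.
rewrite size_scale ?invr_eq0 ?pnatr_eq0 -?lt0n ?fact_gt0 //.
by rewrite size_prod_XsubC /index_enum -enumT size_enum_ord.
Qed.

(** The combination [Y] of the [binp R l] has degree at most j and vanishes at every exponent of p,
    of which [dvdp_exp_support] gives more than j. So [Y] = 0, and only l = j contributes to its
    coefficient at 'X^j. *)
Lemma binomial_combination_eq0 (R : realFieldType) (p : {poly R}) (j : nat) (y : nat -> R) :
  p != 0 -> (1 + 'X) ^+ j.+1 %| p ->
  (forall k, p`_k != 0 -> \sum_(l < j.+1) y l * 'C(k, l)%:R = 0) -> y j = 0.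
Proof.
move=> p_neq0 dvd_p y0.
pose supp := [seq k <- iota 0 (size p) | p`_k != 0].
have lt_supp : (j.+1 < size supp)%N.
  apply: dvdp_exp_support dvd_p => // i pi; rewrite mem_filter pi mem_iota /= add0n.
  by rewrite ltnNge; apply: contraNN pi => /(nth_default 0) ->.
pose Y : {poly R} := \sum_(l < j.+1) y l *: binp R l.
have Y0 : Y = 0.
  apply: (@roots_geq_poly_eq0 _ _ [seq k%:R | k <- supp]).
  - apply/allP => _ /mapP[k + ->]; rewrite mem_filter => /andP[pk _]; apply/eqP.
    rewrite horner_sum -[RHS](y0 _ pk); apply: eq_bigr => l _.
    by rewrite hornerZ horner_binp.
  - by rewrite map_inj_uniq ?filter_uniq ?iota_uniq // => k l /eqP; rewrite eqr_nat => /eqP.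
  - rewrite size_map (leq_trans _ (ltnW lt_supp)) //.
    apply: (leq_trans (size_sum _ _ _)); apply/bigmax_leqP => l _.
    by rewrite (leq_trans (size_scale_leq _ _)) // size_binp ltn_ord.
have := congr1 (fun q : {poly R} => q`_j) Y0.
rewrite coef0 coef_sum big_ord_recr /= big1 ?add0r => [|l _]; last first.
  by rewrite coefZ nth_default ?mulr0 // size_binp ltn_ord.
rewrite coefZ => /eqP; rewrite mulf_eq0 => /orP[/eqP //|].
rewrite [_`_j](_ : _ = lead_coef (binp R j)); last by rewrite lead_coefE size_binp.
by rewrite lead_coef_eq0 -size_poly_eq0 size_binp.
Qed.

Lemma size_mulX_leq (R : realFieldType) (h : {poly R}) : (size ('X * h)%R <= (size h).+1)%N.
Proof. by rewrite (leq_trans (size_polyMleq _ _)) // size_polyX. Qed.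

Lemma poly_split_top (R : realFieldType) (h : {poly R}) (k : nat) : (size h <= k.+1)%N ->
  exists2 g : {poly R}, (size g <= k)%N & h = h`_k *: 'X^k + g.
Proof.
move=> size_h; exists (h - h`_k *: 'X^k); last by rewrite addrC subrK.
apply/leq_sizeP => i; rewrite leq_eqVlt coefB coefZ coefXn => /predU1P[<-|lt_ki].
  by rewrite eqxx mulr1 subrr.
by rewrite gtn_eqF // mulr0 subr0 nth_default // (leq_trans size_h).
Qed.

(** * Functionals with values in R['X] *)

Section Functional.

Variables (R : realFieldType) (d : nat) (y : 'I_d.+1 -> {poly R}).

(** The value on (1 + 'X u)^a h(u) of the functional with weight [y i] at u = i. The indeterminate
    of [h] is u, that of the values is the parameter x. *)
Definition functional (a : nat) (h : {poly R}) : {poly R} :=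
  \sum_i y i * (1 + 'X * i%:R) ^+ a * (h.[i%:R])%:P.

Local Notation Phi := functional.

Lemma functionalD a g h : Phi a (g + h) = Phi a g + Phi a h.
Proof. by rewrite -big_split; apply: eq_bigr => i _ /=; rewrite hornerD polyCD mulrDr. Qed.

Lemma functionalZ a r h : Phi a (r *: h) = r *: Phi a h.
Proof.
rewrite /Phi scaler_sumr; apply: eq_bigr => i _.
by rewrite hornerZ polyCM mulrCA mul_polyC.
Qed.

Lemma functional0 a : Phi a 0 = 0.
Proof. by rewrite -[X in Phi a X](scale0r 0) functionalZ scale0r. Qed.

Lemma functional_sum a (I : Type) (r : seq I) (F : I -> {poly R}) :
  Phi a (\sum_(i <- r) F i) = \sum_(i <- r) Phi a (F i).
Proof.
elim: r => [|i r IH]; last by rewrite !big_cons functionalD IH.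
by rewrite !big_nil functional0.
Qed.

Lemma functionalS a h : Phi a.+1 h = Phi a h + 'X * Phi a ('X * h).
Proof.
rewrite /Phi mulr_sumr -big_split; apply: eq_bigr => i _ /=.
rewrite hornerM hornerX polyCM polyC_natr exprS.
by move: ((1 + _) ^+ a) (h.[_]%:P) => g e; ring.
Qed.

Lemma functional_sample m :
  \sum_i y i * sample 'X m i%:R = Phi m.1.1 ('X ^+ m.1.2 * (1 + 'X) ^+ m.2).
Proof.
apply: eq_bigr => i _; rewrite /sample /monom hornerM !horner_exp hornerD hornerX hornerC.
by rewrite polyCM !polyC_exp polyCD polyC_natr !mulrA.
Qed.

(* That is, 'X^v divides f. *)
Definition low (v : nat) (f : {poly R}) := forall r, (r < v)%N -> f`_r = 0.

Lemma lowD v f g : low v f -> low v g -> low v (f + g).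
Proof. by move=> f0 g0 r lt_rv; rewrite coefD f0 ?g0 ?addr0. Qed.

(** By [functionalS], one more factor 1 + 'X u only adds 'X times a value divisible by 'X^v, at the
    price of one degree in [h]. *)
Lemma functional_shift a v D :
  (forall h : {poly R}, (size h <= D)%N -> low v (Phi a h)) ->
  forall e (h : {poly R}), (size h + e <= D)%N ->
    low v (Phi (a + e) h) /\ (Phi (a + e) h)`_v = (Phi a h)`_v.
Proof.
move=> low_a; elim=> [|e IH] h size_h; first by rewrite addn0 in size_h; rewrite addn0; split=> //; exact: low_a.
have [low1 coef1] : low v (Phi (a + e) h) /\ (Phi (a + e) h)`_v = (Phi a h)`_v.
  by apply: IH; lia.
have [low2 _] : low v (Phi (a + e) ('X * h)) /\ (Phi (a + e) ('X * h))`_v = (Phi a ('X * h))`_v.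
  by apply: IH; rewrite (leq_trans (leq_add (size_mulX_leq h) (leqnn e))) // addSnnS.
have low3 r : (r <= v)%N -> ('X * Phi (a + e) ('X * h))`_r = 0.
  by case: r => [|r] le_rv; rewrite coefXM //= low2.
rewrite addnS functionalS; split; last by rewrite coefD low3 // addr0.
by apply: lowD => // r /ltnW; exact: low3.
Qed.

(** Only the top term 'X^a u^a of (1 + 'X u)^a can bring [h] up to degree k; the others are killed.
    The outer ['X^a] is in the parameter, the inner one in u. *)
Lemma functional_mulXn k :
  (forall h : {poly R}, (size h <= k)%N -> Phi 0 h = 0) ->
  forall a (h : {poly R}), (size h + a <= k.+1)%N -> Phi a h = 'X^a * Phi 0 ('X^a * h).
Proof.
move=> Phi0; elim=> [|a IH] h size_h; first by rewrite expr0 !mul1r.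
rewrite functionalS IH; last by lia.
rewrite Phi0 ?mulr0 ?add0r; last first.
  rewrite (leq_trans (size_polyMleq _ _)) // size_polyXn addSn /=.
  by rewrite addnC -ltnS -addnS.
rewrite IH; last by rewrite (leq_trans (leq_add (size_mulX_leq h) (leqnn a))) // addSnnS.
by rewrite mulrA -exprS (mulrA _ 'X) -exprSr.
Qed.

(** The j-th test polynomial has degree j in u and leading coefficient 'X^(al j): the system is
    triangular, so [Phi 0] kills all degrees up to d. *)
Lemma functional_inj (al : nat -> nat) :
  (forall j, (j <= d)%N -> (al j <= j)%N) ->
  (forall j, (j <= d)%N -> Phi (al j) 'X^(j - al j) = 0) -> forall i, y i = 0.
Proof.
move=> le_al Phi_al.
have Phi0 k : (k <= d.+1)%N -> forall h : {poly R}, (size h <= k)%N -> Phi 0 h = 0.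
  elim: k => [|k IH] le_kd h size_h.
    have /eqP -> : h == 0 by rewrite -size_poly_eq0 -leqn0.
    exact: functional0.
  have [g size_g ->] := poly_split_top size_h.
  rewrite functionalD functionalZ (IH _ g) //; last exact: ltnW.
  have := Phi_al _ le_kd; rewrite (functional_mulXn (IH (ltnW le_kd))); last first.
    by rewrite size_polyXn; have := le_al _ le_kd; lia.
  rewrite -exprD subnKC ?le_al // => /eqP.
  by rewrite mulf_eq0 expf_eq0 polyX_eq0 andbF /= => /eqP ->; rewrite scaler0 addr0.
(* Up to a scalar, the Lagrange polynomial of the node i; it reads off [y i]. *)
move=> i; pose L := \prod_(k < d.+1 | k != i) ('X - (k%:R : R)%:P).
have size_L : (size L <= d.+1)%N.
  rewrite /L -big_filter size_prod_XsubC ltnS size_filter.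
  have := count_predC (pred1 i) (index_enum 'I_d.+1).
  rewrite count_uniq_mem ?index_enum_uniq // mem_index_enum.
  have -> : size (index_enum 'I_d.+1) = d.+1 by rewrite /index_enum -enumT size_enum_ord.
  by rewrite add1n => /succn_inj => /eq_leq.
have := Phi0 _ (leqnn _) L size_L; rewrite /functional (bigD1 i) //= big1 => [|k k_i]; last first.
  rewrite [L.[_]](_ : _ = 0) ?mulr0 //; apply/eqP.
  by rewrite horner_prod; apply/prodf_eq0; exists k => //; rewrite hornerXsubC subrr.
rewrite expr0 mulr1 addr0 => /eqP; rewrite mulf_eq0 => /orP[/eqP //|].
rewrite polyC_eq0 horner_prod => /prodf_eq0[k k_i].
by rewrite hornerXsubC subr_eq0 eqr_nat => /eqP/ord_inj ki; rewrite ki eqxx in k_i.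
Qed.

End Functional.

(** * The quotient of 1 - p by 1 - x1 - x2 - x3 *)

Section LevelForms.

Variables (R : realFieldType) (s : seq exponent) (c : exponent -> R) (d : nat).
Hypothesis c_gt0 : forall m, m \in s -> 0 < c m.
Hypothesis p1 : forall x1 x2 x3 : R, x1 + x2 + x3 = 1 -> peval3 s c x1 x2 x3 = 1.
Hypothesis mdeg_le : forall m, m \in s -> (mdeg m <= d)%N.
Hypothesis mdeg_max : exists2 m, m \in s & mdeg m = d.

Definition yzdeg (m : exponent) : nat := (m.1.2 + m.2)%N.

(* The part of p of degree l, and of degree n in (x2, x3), at x1 = x2 = 1, x3 = 'X. *)
Definition level_form (l n : nat) : {poly R} :=
  \sum_(m <- s | (mdeg m == l) && (yzdeg m == n)) c m *: 'X^(m.2).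

(* The same parts of the forms q_l: q_(l+1) = (x1 + x2 + x3) q_l - p_(l+1). *)
Fixpoint quot_form (l n : nat) : {poly R} :=
  if l is l'.+1 then
    quot_form l' n + (if n is n'.+1 then (1 + 'X) * quot_form l' n' else 0) - level_form l n
  else (n == 0)%:R - level_form 0 n.

Lemma level_small l n : (l < n)%N -> level_form l n = 0.
Proof.
move=> lt_ln; rewrite /level_form big1_seq // => m /andP[/andP[/eqP lE /eqP nE] _].
by exfalso; move: lt_ln; rewrite -lE -nE /yzdeg /mdeg; lia.
Qed.

Lemma quot_small l n : (l < n)%N -> quot_form l n = 0.
Proof.
elim: l n => [|l IH] [|n] // lt_ln /=; first by rewrite level_small // subr0.
by rewrite level_small // !IH ?mulr0 ?addr0 ?subr0 //; lia.
Qed.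

Lemma level_sum l x z :
  \sum_(n < l.+1) x ^+ (l - n) * (level_form l n).[z] =
  \sum_(m <- s | mdeg m == l) c m * (x ^+ m.1.1 * z ^+ m.2).
Proof.
rewrite /level_form; under eq_bigr do rewrite horner_sum mulr_sumr.
rewrite (exchange_big_dep (fun m => mdeg m == l)) => [|n m _ /andP[] //] /=.
apply: eq_bigr => m /eqP ml.
have lt_yz : (yzdeg m < l.+1)%N by rewrite -ml /yzdeg /mdeg; lia.
rewrite (big_pred1 (Ordinal lt_yz)) => [|n]; last by rewrite ml eqxx /= -val_eqE /= eq_sym.
rewrite hornerZ hornerXn mulrCA; congr (_ * (_ ^+ _ * _)) => /=.
by rewrite -ml /yzdeg /mdeg; lia.
Qed.

(** The recursion unrolled from q_0 = 1 - p_0, at the point (x, 1, z). *)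
Lemma quot_sum l x z : let w := x + 1 + z in
  \sum_(n < l.+1) x ^+ (l - n) * (quot_form l n).[z] =
  w ^+ l - \sum_(m <- s | (mdeg m <= l)%N) c m * (x ^+ m.1.1 * z ^+ m.2) * w ^+ (l - mdeg m).
Proof.
move=> w; elim: l => [|l IH].
  rewrite big_ord1 /= hornerD hornerN mulrDr mulrN.
  have := level_sum 0 x z; rewrite big_ord1 /= => ->.
  rewrite expr0 mul1r hornerC; congr (_ - _).
  by apply: eq_big => [m|m _]; rewrite ?leqn0 ?sub0n ?expr0 ?mulr1.
have step : \sum_(n < l.+2) x ^+ (l.+1 - n) * (quot_form l.+1 n).[z] =
    w * (\sum_(n < l.+1) x ^+ (l - n) * (quot_form l n).[z]) -
    \sum_(m <- s | mdeg m == l.+1) c m * (x ^+ m.1.1 * z ^+ m.2).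
  rewrite -level_sum /w -addrA mulrDl.
  under eq_bigr do rewrite /= !hornerE !mulrDr mulrN.
  rewrite !big_split /= sumrN; congr (_ + _ - _).
    rewrite big_ord_recr /= (quot_small (ltnSn l)) horner0 mulr0 addr0 mulr_sumr.
    by apply: eq_bigr => n _; rewrite mulrA -exprS subSn // -ltnS.
  rewrite big_ord_recl /= horner0 mulr0 add0r mulr_sumr.
  by apply: eq_bigr => n _; rewrite subSS hornerM hornerD hornerX hornerC mulrCA.
rewrite step IH mulrBr -exprS -addrA -opprD mulr_sumr; congr (_ - _).
rewrite [RHS](bigID (fun m => mdeg m == l.+1)) /= addrC; congr (_ + _).
  apply: eq_big => [m|m le_ml]; last by rewrite mulrCA -exprS subSn.
  by rewrite andbC -ltn_neqAle ltnS.
apply: eq_big => [m|m /eqP ->]; last by rewrite subnn expr0 mulr1.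
by rewrite andb_idl // => /eqP ->.
Qed.

(** Dividing (x, 1, z) by the sum of its coordinates gives a point of the plane. *)
Lemma homogenized_plane x z : x + 1 + z != 0 ->
  \sum_(m <- s) c m * (x ^+ m.1.1 * z ^+ m.2) * (x + 1 + z) ^+ (d - mdeg m) = (x + 1 + z) ^+ d.
Proof.
set w := x + 1 + z => w_neq0.
rewrite -[RHS]mulr1 -(p1 (_ : x / w + 1 / w + z / w = 1)); last by rewrite /w; field.
rewrite /peval3 mulr_sumr; apply: eq_big_seq => m m_s.
rewrite /monom !expr_div_n expr1n -{2}(subnK (mdeg_le m_s)) exprD {2}/mdeg !exprD.
by field; rewrite ?expf_neq0.
Qed.

(** By [quot_sum] and [homogenized_plane], q_d vanishes at (x, 1, z) whenever x + 1 + z <> 0. *)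
Lemma quot_top n : quot_form d n = 0.
Proof.
have [lt_dn|le_nd] := ltnP d n; first exact: quot_small.
apply: poly_horner_eq0 => z.
(* [W] collects the slices into a polynomial in x; the factor 'X + (1 + z) covers the excluded
   point. *)
pose W : {poly R} := \poly_(i < d.+1) (quot_form d (d - i)).[z].
have : W * ('X + (1 + z)%:P) = 0.
  apply: poly_horner_eq0 => x; rewrite hornerM hornerD hornerX hornerC addrA.
  have [->|w_neq0] := eqVneq (x + 1 + z) 0; first by rewrite mulr0.
  rewrite [W.[x]](_ : _ = 0) ?mul0r // horner_poly (reindex_inj rev_ord_inj) /=.
  rewrite -[RHS](subrr ((x + 1 + z) ^+ d)) -{2}(homogenized_plane w_neq0).
  have := quot_sum d x z => /=.
  have -> F : \sum_(m <- s | (mdeg m <= d)%N) F m = \sum_(m <- s) F m :> R.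
    by rewrite big_seq_cond [RHS]big_seq; apply: eq_bigl => m; rewrite andb_idr // => /mdeg_le.
  move=> <-.
  apply: eq_bigr => i _.
  have le_id : (i <= d)%N by rewrite -ltnS.
  rewrite subSS (subKn le_id).
  exact: mulrC.
move/eqP; rewrite mulf_eq0 => /orP[/eqP W0|]; last first.
  by rewrite -size_poly_eq0 size_XaddC.
have := congr1 (fun q : {poly R} => q`_(d - n)) W0.
by rewrite coef_poly coef0 ltnS leq_subr subKn.
Qed.

(** If q_l = 0, then at (1, 1, 1) the monomials of degree at most l already exhaust the right side
    of [homogenized_plane], leaving no room for a positive term of degree d. *)
Lemma quot_neq0 l : (l < d)%N -> exists2 n, (n <= l)%N & quot_form l n != 0.
Proof.
move=> lt_ld.
have [/forallP q0|/forallPn[n qn]] := boolP [forall n : 'I_l.+1, quot_form l n == 0]; last first.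
  by exists n => //; rewrite -ltnS.
have w_gt0 : 0 < (1 + 1 + 1 : R) by rewrite !addr_gt0.
have := quot_sum l 1 1 => /=; set w := 1 + 1 + 1 in w_gt0 *.
rewrite big1 => [|n _]; last by rewrite (eqP (q0 n)) horner0 mulr0.
move/esym/eqP; rewrite subr_eq0 => /eqP/(congr1 ( *%R (w ^+ (d - l)))).
rewrite -exprD subnK ?(ltnW lt_ld) // -homogenized_plane ?gt_eqF //.
rewrite -/w [LHS](bigID (fun m => (mdeg m <= l)%N)) /= mulr_sumr.
set u := \sum_(m <- s | (mdeg m <= l)%N) _; set v := \sum_(m <- s | _) _.
have -> : \sum_(m <- s | (mdeg m <= l)%N)
    w ^+ (d - l) * (c m * (1 ^+ m.1.1 * 1 ^+ m.2) * w ^+ (l - mdeg m)) = u.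
  apply: eq_bigr => m le_ml; rewrite mulrCA -(exprD w).
  by rewrite (_ : (d - l + (l - mdeg m))%N = (d - mdeg m)%N); last lia.
move/eqP; rewrite -subr_eq0 addrAC subrr add0r => /eqP v0.
case: mdeg_max => m m_s md.
suff : 0 < v by rewrite v0 ltxx.
rewrite /v (big_rem m) //= md -ltnNge lt_ld; apply: ltr_wpDr.
  rewrite big_seq_cond sumr_ge0 // => k /andP[/mem_rem k_s _].
  by rewrite !expr1n !mulr1 mulr_ge0 ?exprn_ge0 ?ltW ?c_gt0.
by rewrite !expr1n !mulr1 mulr_gt0 ?exprn_gt0 ?c_gt0.
Qed.


(* For k > d there is no such monomial, and the value is the junk d + 1. *)
Definition min_x (k : nat) : nat :=
  if k is 0 then 0
  else find (fun a => has (fun m : exponent => (k <= mdeg m)%N && (m.1.1 == a)) s) (iota 0 d.+1).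

Arguments min_x : simpl never.

Lemma min_x_attained k : (0 < k <= d)%N ->
  exists m, [/\ m \in s, (k <= mdeg m)%N & m.1.1 = min_x k].
Proof.
case: k => [//|k] /andP[_ le_kd]; rewrite /min_x.
pose P a := has (fun m : exponent => (k < mdeg m)%N && (m.1.1 == a)) s.
rewrite -[find _ _]/(find P (iota 0 d.+1)).
have has_P : has P (iota 0 d.+1).
  case: mdeg_max => m m_s md; apply/hasP; exists m.1.1.
    by rewrite mem_iota add0n /= ltnS -md /mdeg; lia.
  by apply/hasP; exists m => //; rewrite md le_kd eqxx.
have := nth_find 0%N has_P; rewrite nth_iota ?add0n => [|]; last first.
  by move: has_P; rewrite has_find size_iota.
by case/hasP => m m_s /andP[le_km /eqP mE]; exists m.
Qed.

Lemma min_x_le k m : m \in s -> (k <= mdeg m)%N -> (min_x k <= m.1.1)%N.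
Proof.
case: k => [//|k] m_s le_km; rewrite leqNgt; apply/negP => lt_m.
have := before_find 0%N lt_m; rewrite nth_iota ?add0n; last first.
  by rewrite ltnS (leq_trans _ (mdeg_le m_s)) // /mdeg -addnA leq_addr.
by move/negP; apply; apply/hasP; exists m => //; rewrite le_km eqxx.
Qed.

Lemma min_x_mono k l : (k <= l)%N -> (l <= d)%N -> (min_x k <= min_x l)%N.
Proof.
case: k => [//|k] le_kl le_ld.
have [|m [m_s le_lm <-]] := @min_x_attained l; first by rewrite le_ld andbT; lia.
by apply: min_x_le => //; lia.
Qed.

(* x1 ^ min_x (l + 1) divides q_l. *)
Lemma quot_vanish l n : (l < d)%N -> (l < n + min_x l.+1)%N -> quot_form l n = 0.
Proof.
(* Downward induction on l from q_d = 0, and within it on n from n > l. *)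
move: {2}(d - l)%N (leqnn (d - l)) => r; elim: r l n => [|r IHl] l n; first by lia.
move=> le_r lt_ld.
move: {2}(l.+1 - n)%N (leqnn (l.+1 - n)) => q; elim: q n => [|q IHn] n le_q lt_n.
  by apply: quot_small; lia.
have quotS0 : quot_form l.+1 n.+1 = 0.
  have [lt_Sd|ge_Sd] := ltnP l.+1 d; last first.
    have -> : l.+1 = d by lia.
    exact: quot_top.
  by apply: IHl => //; have := min_x_mono (leqnSn l.+1) lt_Sd; lia.
(* In the recursion for the slice n + 1 of q_(l+1), all that remains is (1 + 'X) times the slice n
   of q_l. *)
have := quotS0; rewrite /= IHn; [|by lia|by lia].
rewrite [level_form _ _]big1_seq => [|m /andP[/andP[/eqP ml /eqP mn] m_s]]; last first.
  exfalso; have := min_x_le (k := l.+1) m_s; rewrite ml leqnn => /(_ isT).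
  by case: m ml mn {m_s} => [[a b] e]; rewrite /yzdeg /mdeg /=; lia.
rewrite add0r subr0 => /eqP; rewrite mulf_eq0 => /orP[|/eqP //].
by rewrite addrC -polyC1 -size_poly_eq0 size_XaddC.
Qed.

(** Otherwise x1^k would divide the nonzero form q_(k-1) of degree k - 1. *)
Lemma min_x_leq k : (k <= d)%N -> (min_x k <= k)%N.
Proof.
case: k => [//|l] lt_ld; have [n le_nl quot_n] := quot_neq0 lt_ld.
rewrite leqW //; apply: contraNleq quot_n => lt_l.
by rewrite quot_vanish //; lia.
Qed.

End LevelForms.

Arguments min_x : simpl never.

(** * Truncated sums and binomial expansions *)

Lemma big_ord_trunc (R : nmodType) (m p : nat) (F : nat -> R) :
  (m <= p)%N -> (forall i, (m <= i < p)%N -> F i = 0) -> \sum_(i < p) F i = \sum_(i < m) F i.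
Proof.
move=> le_mp F0; rewrite -!(big_mkord xpredT) (big_cat_nat (n := m)) //=.
by rewrite [X in _ + X]big_nat [X in _ + X]big1 ?addr0.
Qed.

Lemma mulXn_expDn (R : realFieldType) (a b : nat) :
  'X^a * (1 + 'X) ^+ b = \sum_(i < b.+1) 'C(b, i)%:R *: 'X^(a + b - i) :> {poly R}.
Proof.
rewrite addrC exprDn mulr_sumr; apply: eq_bigr => i _.
rewrite expr1n mulr1 mulrnAr -exprD scaler_nat; congr ('X^_ *+ _).
by have := ltn_ord i; lia.
Qed.

Lemma size_mulXn_expDn (R : realFieldType) (a b : nat) :
  (size ('X^a * (1 + 'X) ^+ b : {poly R})%R <= (a + b).+1)%N.
Proof.
rewrite mulXn_expDn (leq_trans (size_sum _ _ _)) //; apply/bigmax_leqP => i _.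
by rewrite (leq_trans (size_scale_leq _ _)) // size_polyXn ltnS leq_subr.
Qed.

Section Spanning.

Variables (R : realFieldType) (s : seq exponent) (c : exponent -> R) (d : nat).
Hypothesis c_gt0 : forall m, m \in s -> 0 < c m.
Hypothesis p1 : forall x1 x2 x3 : R, x1 + x2 + x3 = 1 -> peval3 s c x1 x2 x3 = 1.
Hypothesis mdeg_le : forall m, m \in s -> (mdeg m <= d)%N.
Hypothesis mdeg_max : exists2 m, m \in s & mdeg m = d.

Local Notation al := (min_x s d).
Local Notation quot := (quot_form s c).
Local Notation level := (level_form s c).

(** * Windows: visible monomials grouped by their degree in (x2, x3) *)

Section Window.

Variable e : nat.

(* A monomial of degree l > e and (x2, x3)-degree n is visible if, modulo higher
   order, its powers of 1 + 'X u can be traded for those available at level e. *)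
Definition visible (n l : nat) : bool :=
  (l <= d)%N && [forall j : 'I_d, (e <= j < l)%N ==> (n + al j.+1 <= j)%N].

Lemma visibleP n l :
  reflect ((l <= d)%N /\ forall j, (e <= j < l)%N -> (n + al j.+1 <= j)%N) (visible n l).
Proof.
apply: (iffP andP) => -[le_ld vis]; split=> //.
  move=> j jl; have lt_jd : (j < d)%N by lia.
  by move/forallP/(_ (Ordinal lt_jd))/implyP: vis; apply.
by apply/forallP => j; apply/implyP; exact: vis.
Qed.

Lemma visible_early n l : (l <= e <= d)%N -> visible n l.
Proof. by move=> le_led; apply/visibleP; split=> [|j]; lia. Qed.

Lemma visible_sub n n' l l' : (n' <= n)%N -> (l' <= l)%N -> visible n l -> visible n' l'.
Proof.
move=> le_n le_l /visibleP[le_ld vis]; apply/visibleP; split=> [|j jl]; first by lia.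
by have := vis j; lia.
Qed.

(** Where visibility is lost, [quot_vanish] applies: windows can be cut off there. *)
Lemma visible_next n l : (l < d)%N -> visible n l -> ~~ visible n l.+1 -> (l < n + al l.+1)%N.
Proof.
move=> lt_ld /visibleP[_ vis]; apply: contraNltn => le_nl; apply/visibleP; split=> // j jl.
by have [->//|j_l] := eqVneq j l; apply: vis; lia.
Qed.

Definition window (n l : nat) (m : exponent) : bool :=
  [&& (l < mdeg m)%N, yzdeg m == n & visible n (mdeg m)].

Definition window_form (n l : nat) : {poly R} :=
  \sum_(m <- s | window n l m) c m *: 'X^(m.2).

Lemma window_form_step n l : visible n l.+1 ->
  window_form n l = level l.+1 n + window_form n l.+1.
Proof.
move=> vis; rewrite /window_form (bigID (fun m => mdeg m == l.+1)) /=; congr (_ + _).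
  apply: eq_bigl => m; rewrite /window andbC.
  by case: eqP => //= ->; rewrite ltnSn vis andbT.
by apply: eq_bigl => m; rewrite /window andbC andbA; congr (_ && _); lia.
Qed.

Lemma window_form_end n l : ~~ visible n l.+1 -> window_form n l = 0.
Proof.
move=> nvis; rewrite /window_form big1 // => m /and3P[lt_lm _ vis].
by case/negP: nvis; exact: visible_sub vis.
Qed.

(** Passing from l to l + 1 changes the difference by (1 + 'X) times the slice n - 1 of q_l; both of
    its terms vanish at the last visible degree. *)
Lemma dvdp_window_step (k n r : nat) : (k <= e)%N ->
  (forall l, (k <= l.+1)%N -> visible n l ->
     (1 + 'X) ^+ r %| (if n is n'.+1 then quot l n' else 0)) ->
  forall l, (k <= l.+1)%N -> visible n l -> (1 + 'X) ^+ r.+1 %| quot l n - window_form n l.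
Proof.
move=> le_ke dvd_prev l; move: {2}(d - l)%N (leqnn (d - l)) => q; elim: q l => [|q IHq] l le_q le_kl vis_l.
  have -> : l = d by case/visibleP: vis_l; lia.
  by rewrite (quot_top p1 mdeg_le) window_form_end ?subr0 ?dvdp0 //; apply/visibleP; lia.
have [->|l_d] := eqVneq l d.
  by rewrite (quot_top p1 mdeg_le) window_form_end ?subr0 ?dvdp0 //; apply/visibleP; lia.
have lt_ld : (l < d)%N by case/visibleP: vis_l; lia.
have [vis_Sl|nvis_Sl] := boolP (visible n l.+1); last first.
  rewrite window_form_end // (quot_vanish p1 mdeg_le mdeg_max lt_ld) ?subr0 ?dvdp0 //.
  exact: visible_next.
have IHl : (1 + 'X) ^+ r.+1 %| quot l.+1 n - window_form n l.+1 by apply: IHq => //; lia.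
rewrite window_form_step // opprD addrA.
have := dvd_prev _ le_kl vis_l; set prev := (if n is n'.+1 then _ else 0) => dvd_prev_l.
have quotE : quot l.+1 n = quot l n + (1 + 'X) * prev - level l.+1 n.
  by rewrite /prev /=; case: (n) => [|n'] //; rewrite mulr0.
have -> : quot l n - level l.+1 n - window_form n l.+1 =
    quot l.+1 n - window_form n l.+1 - (1 + 'X) * prev by rewrite quotE; ring.
by rewrite dvdp_sub // exprS dvdp_mul.
Qed.

(* Each empty window forces one more factor 1 + 'X in the next one. *)
Lemma dvdp_window (k N j : nat) : (0 < k <= e)%N ->
  (forall i, (i < j)%N -> ~~ has (window (N + i) k.-1) s) ->
  forall l, (k <= l.+1)%N -> visible (N + j) l ->
    (1 + 'X) ^+ j.+1 %| quot l (N + j) - window_form (N + j) l.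
Proof.
move=> /andP[k_gt0 le_ke]; elim: j => [|j IHj] empty;
  apply: dvdp_window_step le_ke _ => l le_kl vis_l.
  by rewrite expr0 dvd1p.
rewrite addnS in vis_l *.
have vis' : visible (N + j) l by exact: visible_sub vis_l.
(* The window [N + j] is empty, so the slice [N + j] of q_l is itself divisible. *)
have := IHj _ l le_kl vis'; rewrite /window_form big1_seq ?subr0 => [|m /andP[wm m_s]].
  by apply => i lt_ij; apply: empty; exact: ltnW.
exfalso; move/negP: (empty j (ltnSn j)); apply; apply/hasP; exists m => //.
by case/and3P: wm => lt_lm yz_m vis_m; apply/and3P; split=> //; lia.
Qed.

Lemma coef_window_form n l r :
  (window_form n l)`_r = \sum_(m <- s | window n l m && (m.2 == r)) c m.
Proof.
rewrite coef_sum [RHS]big_mkcondr /=; apply: eq_bigr => m _.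
by rewrite coefZ coefXn eq_sym; case: eqP => _; rewrite ?mulr1 ?mulr0.
Qed.

Lemma window_form_coef_neq0 n l r : (window_form n l)`_r != 0 ->
  exists m, [/\ m \in s, window n l m & m.2 = r].
Proof.
rewrite coef_window_form => nz.
have [/hasP[m m_s /andP[wm /eqP mr]]|/hasPn none] :=
  boolP (has (fun m => window n l m && (m.2 == r)) s); first by exists m.
case/negP: nz; rewrite big1_seq // => m /andP[wm m_s].
by move: (none m m_s); rewrite wm.
Qed.

(** Positivity: monomials merged by x1 = x2 = 1 cannot cancel. *)
Lemma window_form_neq0 n l : has (window n l) s -> window_form n l != 0.
Proof.
case/hasP => m m_s wm; apply/eqP => form0.
have := coef_window_form n l m.2; rewrite form0 coef0 => /eqP.
rewrite (big_rem m) //= wm eqxx /= lt_eqF // ltr_wpDr ?c_gt0 // big_seq_cond sumr_ge0 // => k' /andP[/mem_rem k_s _].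
exact/ltW/c_gt0.
Qed.

End Window.

Variable y : 'I_d.+1 -> {poly R}.
Local Notation Phi := (functional y).
Hypothesis Phi_1 : Phi 0 1 = 0.
Hypothesis Phi_s : forall m, m \in s -> Phi m.1.1 ('X ^+ m.1.2 * (1 + 'X) ^+ m.2) = 0.

(** * The coefficients at 'X^v of the test values *)

Section LowestCoefficient.

Variable v : nat.
Hypothesis low_top : forall j, (j <= d)%N -> low v (Phi (al j) 'X^(j - al j)).

(** The top term is controlled by [low_top]; the rest has small enough degree to come from level k -
    1 by [functional_shift]. *)
Lemma functional_low k : (k <= d)%N ->
  forall h : {poly R}, (size h <= (k - al k).+1)%N -> low v (Phi (al k) h).
Proof.
elim: k => [|k IHk] le_kd h size_h; have [g size_g ->] := poly_split_top size_h.
  rewrite functionalD functionalZ; have -> : g = 0 by apply/eqP; rewrite -size_poly_leq0.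
  by move=> r lt_rv; rewrite functional0 addr0 coefZ low_top ?mulr0.
rewrite functionalD functionalZ; apply: lowD.
  by move=> r lt_rv; rewrite coefZ low_top ?mulr0.
have le_al : (al k <= al k.+1)%N by exact: min_x_mono.
have le_k := min_x_leq c_gt0 p1 mdeg_le mdeg_max (ltnW le_kd).
have le_k1 := min_x_leq c_gt0 p1 mdeg_le mdeg_max le_kd.
rewrite -(subnKC le_al).
by case: (functional_shift (IHk (ltnW le_kd)) (e := al k.+1 - al k) (h := g)); first by lia.
Qed.

Lemma coef_shift k b (h : {poly R}) : (k <= d)%N -> (al k <= b)%N ->
  (size h + b <= k.+1)%N -> (Phi b h)`_v = (Phi (al k) h)`_v.
Proof.
move=> le_kd le_b size_h.
have le_k := min_x_leq c_gt0 p1 mdeg_le mdeg_max le_kd.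
rewrite -{1}(subnKC le_b).
by case: (functional_shift (functional_low le_kd) (e := b - al k) (h := h)); first by lia.
Qed.

(** Climbs one level at a time, trading [al j] for [al j.+1]; [visible] supplies the size bound. *)
Lemma coef_chain k l (h : {poly R}) : (k <= l)%N -> (l <= d)%N ->
  (forall j, (k <= j < l)%N -> (size h + al j.+1 <= j.+1)%N) ->
  (Phi (al l) h)`_v = (Phi (al k) h)`_v.
Proof.
elim: l => [|l IHl]; first by rewrite leqn0 => /eqP ->.
rewrite leq_eqVlt => /predU1P[->//|]; rewrite ltnS => le_kl lt_ld size_h.
rewrite -IHl ?(ltnW lt_ld) //; last by move=> j jl; apply: size_h; lia.
apply: coef_shift; [exact: ltnW|exact: min_x_mono|].
by apply: size_h; lia.
Qed.

Lemma coef_eq0 k : (forall j, (j < k)%N -> (Phi (al j) 'X^(j - al j))`_v = 0) ->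
  forall j (h : {poly R}), (j < k)%N -> (j <= d)%N -> (size h <= (j - al j).+1)%N ->
  (Phi (al j) h)`_v = 0.
Proof.
move=> top0; elim=> [|j IHj] h lt_jk le_jd size_h; have [g size_g ->] := poly_split_top size_h.
  rewrite functionalD functionalZ; have -> : g = 0 by apply/eqP; rewrite -size_poly_leq0.
  by rewrite functional0 addr0 coefZ top0 ?mulr0.
have le_al : (al j <= al j.+1)%N by exact: min_x_mono.
have le_j := min_x_leq c_gt0 p1 mdeg_le mdeg_max (ltnW le_jd).
have le_j1 := min_x_leq c_gt0 p1 mdeg_le mdeg_max le_jd.
rewrite functionalD functionalZ coefD coefZ top0 // mulr0 add0r.
rewrite (coef_shift (ltnW le_jd) le_al) ?IHj //; lia.
Qed.

(** At this level e, the least power of x1 is attained by a monomial of degree exactly e. *)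
Lemma last_level_with_same_min_x k : (k <= d)%N ->
  exists e, [/\ (k <= e <= d)%N, al e = al k & forall l, (e < l <= d)%N -> al l != al k].
Proof.
move=> le_kd; pose P l := (l <= d)%N && (al l == al k).
have exP : exists l, P l by exists k; rewrite /P le_kd eqxx.
have [|e /andP[le_ed /eqP al_e] e_max] := ex_maxnP exP (m := d); first by move=> l /andP[].
exists e; split=> //; first by rewrite le_ed e_max // /P le_kd eqxx.
move=> l /andP[lt_el le_ld]; apply/negP => al_l.
by have := e_max l; rewrite /P le_ld al_l => /(_ isT); lia.
Qed.

(** The relation [Phi_s] of a visible monomial is carried from its own power of 1 + 'X u to that of
    its degree, then down to level e, where [al e = al k]. *)
Lemma coef_window_eq0 k e n m : (0 < k <= e)%N -> (e <= d)%N -> al e = al k ->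
  m \in s -> window e n k.-1 m -> (Phi (al k) ('X^(m.1.2) * (1 + 'X) ^+ m.2))`_v = 0.
Proof.
move=> /andP[k_gt0 le_ke] le_ed al_e m_s /and3P[lt_km /eqP yz_m /visibleP[le_ld vis]].
set l := mdeg m in lt_km le_ld vis; set h := _ * _.
have le_kl : (k <= l)%N by lia.
have size_h : (size h <= n.+1)%N by rewrite -yz_m; exact: size_mulXn_expDn.
have lE : (m.1.1 + n)%N = l by rewrite -yz_m /yzdeg addnA.
have coef_l : (Phi (al l) h)`_v = 0.
  rewrite -(coef_shift le_ld (min_x_le mdeg_le m_s (leqnn _))) ?Phi_s ?coef0 //.
  by rewrite -/l -lE; lia.
have [le_le|lt_el] := leqP l e.
  suff -> : al k = al l by [].
  by apply/eqP; rewrite eqn_leq -{2}al_e !(min_x_mono mdeg_le mdeg_max).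
rewrite -al_e -(coef_chain (ltnW lt_el) le_ld) // => j jl.
by rewrite (leq_trans (leq_add size_h (leqnn _))) // addSn ltnS vis.
Qed.

Lemma coef_top_eq0 k : (k <= d)%N -> (Phi (al k) 'X^(k - al k))`_v = 0.
Proof.
elim/ltn_ind: k => -[|k'] IHk le_kd; first by rewrite expr0 Phi_1 coef0.
set k := k'.+1 in IHk le_kd *; set N := (k - al k)%N.
have le_alk := min_x_leq c_gt0 p1 mdeg_le mdeg_max le_kd.
have le_alk' := min_x_leq c_gt0 p1 mdeg_le mdeg_max (ltnW le_kd).
have le_al' : (al k' <= al k)%N by exact: min_x_mono.
have coef_small (h : {poly R}) : (size h <= N)%N -> (Phi (al k) h)`_v = 0.
  move=> size_h; rewrite (coef_shift (ltnW le_kd) le_al'); last by rewrite /N in size_h; lia.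
  apply: (coef_eq0 (k := k)) => //; last 1 first.
  - by rewrite (leq_trans size_h) // /N; lia.
  - by move=> j lt_jk; apply: IHk => //; lia.
  - exact: ltnW.
have [e [/andP[le_ke le_ed] al_e e_max]] := last_level_with_same_min_x le_kd.
(* A monomial with least x1-exponent in degree at least e has degree e, hence degree e - al k = N +
   (e - k) in (x2, x3). *)
have ex_window : exists i, has (window e (N + i) k.-1) s.
  have [m [m_s le_em m1]] : exists m, [/\ m \in s, (e <= mdeg m)%N & m.1.1 = al e].
    by apply: (min_x_attained mdeg_max); rewrite le_ed andbT; lia.
  have mE : mdeg m = e.
    apply/eqP; rewrite eqn_leq le_em andbT leqNgt; apply/negP => lt_em.
    have := e_max (mdeg m); rewrite lt_em mdeg_le // => /(_ isT)/negP; apply.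
    rewrite eqn_leq -{1}al_e -m1 (min_x_le mdeg_le) //=.
    apply: (min_x_mono mdeg_le mdeg_max); last exact: mdeg_le.
    exact: leq_trans le_em.
  exists (e - k)%N; apply/hasP; exists m => //; rewrite /window mE le_ke visible_early ?leqnn // andbT /=.
  have : (m.1.1 + yzdeg m)%N = e by rewrite -mE /yzdeg addnA.
  by rewrite m1 al_e /N; lia.
have [j has_j j_min] := ex_minnP ex_window.
have empty i : (i < j)%N -> ~~ has (window e (N + i) k.-1) s.
  by move=> lt_ij; apply/negP => /j_min; rewrite leqNgt lt_ij.
have dvd_form : (1 + 'X) ^+ j.+1 %| window_form e (N + j) k.-1.
  (* q_(k-1) has no slice [N + j], so the window form alone is divisible. *)
  have := dvdp_window (k := k) le_ke empty (l := k').
  rewrite (quot_vanish p1 mdeg_le mdeg_max) ?sub0r; [|exact: le_kd|rewrite -/k; lia].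
  by rewrite dvdpNr; apply=> //; apply: visible_early => //; lia.
(* The unknowns belong to the powers N + j down to N of u; lower ones vanish by [coef_small], and
   the last, i = j, is the one wanted. *)
have := binomial_combination_eq0 (y := fun i => (Phi (al k) 'X^(N + j - i))`_v)
  (window_form_neq0 has_j) dvd_form.
rewrite addnK; apply=> r /window_form_coef_neq0[m [m_s wm <-]].
have /eqP yz_m : yzdeg m == (N + j)%N by case/and3P: wm.
have := coef_window_eq0 _ le_ed al_e m_s wm; rewrite mulXn_expDn functional_sum coef_sum.
rewrite le_ke => /(_ isT).
under eq_bigr do rewrite functionalZ coefZ mulrC -/(yzdeg m) yz_m.
pose F i := (Phi (al k) 'X^(N + j - i))`_v * 'C(m.2, i)%:R.
(* The sums up to j and up to [m.2] are both truncations of the sum up to N + j. *)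
move=> sum0; rewrite -[LHS](big_ord_trunc (p := (N + j).+1) (F := F)); first last.
- move=> i /andP[lt_ji lt_i]; rewrite /F coef_small ?mul0r // size_polyXn; lia.
- by rewrite ltnS leq_addl.
rewrite (big_ord_trunc (m := m.2.+1)) // => [|i /andP[lt_ri _]].
  by rewrite ltnS -yz_m /yzdeg leq_addl.
by rewrite /F bin_small ?mulr0.
Qed.

End LowestCoefficient.

Lemma functional_top_eq0 j : (j <= d)%N -> Phi (al j) 'X^(j - al j) = 0.
Proof.
move=> le_jd; have low_all v : forall i, (i <= d)%N -> low v (Phi (al i) 'X^(i - al i)).
  elim: v => [|v IHv] i le_id r //; rewrite ltnS leq_eqVlt => /predU1P[->|].
    exact: coef_top_eq0.
  exact: IHv.
apply/polyP => r; rewrite coef0; exact: (low_all r.+1).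
Qed.

Lemma functional_trivial i : y i = 0.
Proof.
apply: functional_inj functional_top_eq0 i => j.
exact: (min_x_leq c_gt0 p1 mdeg_le mdeg_max).
Qed.

End Spanning.

(** * The degree bound *)

Lemma pdeg3_attained s : s != [::] -> exists2 m, m \in s & mdeg m = pdeg3 s.
Proof.
elim: s => [//|m s IHs] _; rewrite /pdeg3 big_cons.
have [s0|/IHs[m' m'_s m'E]] := eqVneq s [::].
  by exists m; rewrite ?mem_head // s0 big_nil maxn0.
have [le_m|lt_m] := leqP (mdeg m) (\max_(i <- s) mdeg i).
  by exists m'; rewrite ?inE ?m'_s ?orbT.
by exists m; rewrite ?mem_head.
Qed.

Theorem theorem1p2 (R : realFieldType) (s : seq (nat * nat * nat))
  (c : nat * nat * nat -> R) :
  uniq s ->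
  (forall m, m \in s -> 0 < c m) ->
  (forall x1 x2 x3 : R, x1 + x2 + x3 = 1 -> peval3 s c x1 x2 x3 = 1) ->
  (pdeg3 s)%:R <= ((size s)%:R - 1) / 2 :> R.
Proof.
move=> _ c_gt0 p1; set d := pdeg3 s.
have mdeg_le m : m \in s -> (mdeg m <= d)%N.
  by move=> m_s; exact: (leq_bigmax_seq (P := xpredT)).
have mdeg_max : exists2 m, m \in s & mdeg m = d.
  apply: pdeg3_attained; apply/eqP => s0; have := p1 1 0 0; rewrite !addr0 => /(_ erefl)/eqP.
  by rewrite s0 /peval3 big_nil eq_sym oner_eq0.
have ker0 (y : 'I_d.+1 -> {poly R}) :
    (forall m, m \in (0, 0, 0)%N :: s -> \sum_i y i * sample 'X m i%:R = 0) -> forall i, y i = 0.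
  move=> y0; apply: (functional_trivial c_gt0 p1 mdeg_le mdeg_max) => [|m m_s].
    by have := y0 _ (mem_head _ _); rewrite functional_sample /= !expr0 mulr1.
  by rewrite -functional_sample y0 // inE m_s orbT.
have [x [x_neq0 x_neq1 free]] := exists_row_free ker0.
have := size_of_row_free c_gt0 p1 x_neq0 x_neq1 free.
rewrite -(ler_nat R) natrM -!natr1 => bound.
by rewrite ler_pdivlMr //; lra.
Qed.
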